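(* Let $M>0$. Suppose that for each $n\in\mathbb{N}$, $P_n(z)=a_n\prod_{k=1}^n (z-\alpha_{k,n})$ is a polynomial of exact degree $n$ with integer coefficients, with $n$ simple (pairwise distinct) zeros $\alpha_{1,n},\dots,\alpha_{n,n}$ all lying in the closed unit disk $D=\{z\in\mathbb{C}:|z|\le 1\}$, and with leading coefficient satisfying $|a_n|\le M$. Let $\tau_n=\frac1n\sum_{k=1}^n\delta_{\alpha_{k,n}}$. Then $\tau_n$ converges weakly to $\mu_D$ as $n\to\infty$.
   Context: $\delta_\alpha$ denotes the unit point mass at $\alpha$. $\mu_D$ is the normalized arclength measure on the unit circle, $d\mu_D(e^{it})=\frac{1}{2\pi}dt$. Weak convergence $\tau_n\to\mu$ means $\int\phi\,d\tau_n\to\int\phi\,d\mu$ for every continuous compactly supported $\phi:\mathbb{C}\to\mathbb{R}$. *)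

(* Defs.v *)
From HB Require Import structures.
From mathcomp Require Import all_boot all_order all_algebra complex.
From mathcomp Require Import all_classical all_reals all_analysis.
From mathcomp Require Import measurable_realfun.

Set Implicit Arguments.
Unset Strict Implicit.
Unset Printing Implicit Defensive.

Import Order.TTheory GRing.Theory Num.Theory.
Import numFieldNormedType.Exports.

Local Open Scope classical_set_scope.
Local Open Scope ring_scope.
Local Open Scope complex_scope.

(* [R[i]^o] carries the topology of the norm [`|x +i* y| = sqrt (x^2 + y^2)];
   it is not inherited by the concrete type [R[i]]. *)
HB.instance Definition _ (R : rcfType) := NormedModule.copy R[i] R[i]^o.

(* [R[i]] with its Borel sigma-algebra. *)
Notation borelC R := (g_sigma_algebraType (open : set (set R[i]))).

Section measures_on_C.
Context {R : realType}.

Lemma continuous_real_complex : continuous (real_complex R : R -> R[i]).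
Proof.
move=> x; apply/cvgrPdist_lt => e e0.
have [Re0 Ime] : 0 < complex.Re e /\ e = (complex.Re e)%:C.
  case: e e0 => a b; rewrite ltcE /= => /andP[/eqP b0 a0].
  by split => //; rewrite b0.
near=> y.
rewrite -rmorphB normc_def /= expr0n /= addr0 sqrtr_sqr Ime ltcR.
near: y.
by apply: (@cvgr_dist_lt _ _ _ _ _ id x); [exact: cvg_id|].
Unshelve. all: by end_near. Qed.

Definition expi (t : R) : borelC R := cos t +i* sin t.

Lemma continuous_expi : continuous (expi : R -> R[i]).
Proof.
have -> : (expi : R -> R[i]) = fun t => (cos t)%:C + 'i * (sin t)%:C.
  by apply/funext => t; rewrite /expi; simpc.
move=> t; apply: cvgD.
  by apply: continuous_comp; [exact: continuous_cos|
    exact: continuous_real_complex].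
apply: cvgM; first exact: cvg_cst.
by apply: continuous_comp; [exact: continuous_sin|
  exact: continuous_real_complex].
Qed.

Lemma measurable_expi : measurable_fun [set: R] expi.
Proof.
apply: (@measurability _ _ R (borelC R) setT expi open) => //.
move=> _ [B oB <-]; rewrite setTI.
by apply: open_measurable; apply: open_comp oB => x _; exact: continuous_expi.
Qed.

HB.instance Definition _ := isMeasurableFun.Build _ _ _ _ expi measurable_expi.

Lemma inv_2pi_ge0 : 0 <= (2 * pi)^-1 :> R.
Proof. by rewrite invr_ge0 mulr_ge0// pi_ge0. Qed.

Definition circle_measure : set (borelC R) -> \bar R :=
  pushforward
    (mscale (NngNum inv_2pi_ge0)
       (mrestr lebesgue_measure (measurable_itv `[0, 2 * pi]))) expi.

Let circle_measure0 : circle_measure set0 = 0%E.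
Proof. by rewrite /circle_measure measure0//; exact: measurable_expi. Qed.

Let circle_measure_ge0 A : (0 <= circle_measure A)%E.
Proof. by rewrite /circle_measure; apply: measure_ge0; exact: measurable_expi. Qed.

Let circle_measure_sigma_additive : semi_sigma_additive circle_measure.
Proof.
by rewrite /circle_measure; apply: measure_semi_sigma_additive; exact: measurable_expi.
Qed.

HB.instance Definition _ := isMeasure.Build _ _ _ circle_measure
  circle_measure0 circle_measure_ge0 circle_measure_sigma_additive.

(* For n = 0 this is the zero measure. *)
Definition zero_counting n (s : n.-tuple R[i]) : set (borelC R) -> \bar R :=
  mscale (n%:R^-1)%:nng (msum (fun k => \d_(s`_k : borelC R)) n).

HB.instance Definition _ n (s : n.-tuple R[i]) :=
  Measure.on (zero_counting s).

Definition weak_cvg (tau : {measure set (borelC R) -> \bar R}^nat)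
    (mu : {measure set (borelC R) -> \bar R}) :=
  forall phi : R[i] -> R, continuous phi ->
    compact (closure [set z | phi z != 0]) ->
    (\int[tau n]_z (phi z)%:E @[n --> \oo] --> \int[mu]_z (phi z)%:E)%E.

End measures_on_C.

(* Main.v *)
(** Let [L = ln M].  The resultant of [P_n] and its derivative is a nonzero
    integer, which bounds the logarithmic energy:
    [sum_(k <> j) - ln |x_k - x_j| <= 2 n L].  In the unit disk
    [(1 + r) / 2 * |z - w| <= |1 - r z w^*|] for [0 <= r <= 1], so summing the
    positive definite kernel
    [- ln |1 - r z w^*| = sum_(m >= 1) r^m / m Re ((z w^* )^m)]
    over all pairs of zeros gives, with [p_m] the m-th power sum of the zeros,
    [sum_(m >= 1) r^m / m |p_m|^2 <= 2 n L - n ln (1 - r) + n^2 (1 - r)].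
    Letting [n] go to infinity,
    then [r] to 1, gives [p_m / n --> 0] for every [m >= 1].  On the other hand
    the lowest nonzero coefficient of [P_n] is an integer, so that
    [sum_k (1 - |x_k|) <= 1 + L]: the zeros accumulate on the circle.  Testing
    against Fejer kernels turns these two facts into weak convergence. *)
Require Import Defs.
From HB Require Import structures.
From mathcomp Require Import all_boot all_order all_algebra complex.
From mathcomp Require Import all_classical all_reals all_analysis.
From mathcomp Require Import measurable_realfun ring lra.

Set Implicit Arguments.
Unset Strict Implicit.
Unset Printing Implicit Defensive.

Import Order.TTheory GRing.Theory Num.Theory.
Import numFieldNormedType.Exports.

Local Open Scope classical_set_scope.
Local Open Scope ring_scope.
Local Open Scope complex_scope.

Import ComplexField.Normc.
Local Notation Re := complex.Re.

(** * The resultant of a polynomial and its derivative *)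

(* The matrix [S] is (a row-permuted) Sylvester matrix of [P] and its
   derivative; multiplying it by evaluation at the roots in the low degrees and
   by the identity in the high degrees makes it block triangular. *)
Lemma int_discriminant (F : fieldType) n (P : {poly int})
    (x : 'I_n.+1 -> F) : size P = n.+2 ->
  (forall k, root (map_poly intr P) (x k)) -> injective x ->
  exists d : int, d%:~R =
    (lead_coef P)%:~R ^+ n * \prod_k (map_poly intr P)^`().[x k] :> F.
Proof.
move=> sP rx injx.
pose Sul : 'M[int]_n.+1 := \matrix_(i, j) ('X^i * P^`())`_j.
pose Sur : 'M[int]_(n.+1, n) := \matrix_(i, j) ('X^i * P^`())`_(n.+1 + j).
pose Sdl : 'M[int]_(n, n.+1) := \matrix_(i, j) ('X^i * P)`_j.
pose Sdr : 'M[int]_n := \matrix_(i, j) ('X^i * P)`_(n.+1 + j).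
pose S := block_mx Sul Sur Sdl Sdr.
pose V : 'M[F]_n.+1 := Vandermonde n.+1 (\row_k x k).
pose W : 'M[F]_(n, n.+1) := \matrix_(i, k) x k ^+ (n.+1 + i).
pose f := (intr : int -> F).
pose Pf := map_poly f P.
(* The rows of [S] list coefficients of polynomials, so the product of a row with the first block
   column of the right factor is evaluation at [x k]. *)
have ev (Q : {poly int}) k : (size Q <= n.+1 + n)%N ->
    \sum_(j < n.+1) (Q`_j)%:~R * x k ^+ j +
    \sum_(j < n) (Q`_(n.+1 + j))%:~R * x k ^+ (n.+1 + j) =
    (map_poly f Q).[x k].
  move=> sQ; rewrite (@horner_coef_wide _ (n.+1 + n)); last first.
    by rewrite (leq_trans (size_poly _ _)).
  rewrite big_split_ord /=; congr (_ + _); apply: eq_bigr => j _.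
    by rewrite coef_map.
  by rewrite coef_map.
have sP' : (size P^`() <= n.+1)%N.
  by rewrite -ltnS -sP lt_size_deriv // -size_poly_eq0 sP.
have szX (Q : {poly int}) (i m : nat) : (size Q <= m)%N ->
    (size ('X^i * Q)%R <= m + i)%N.
  by move=> sQ; apply: leq_trans (size_polyMleq _ _) _;
    rewrite size_polyXn /= addnC leq_add2r.
have prodE : map_mx f S *m block_mx V 0 W 1%:M =
    block_mx (V *m diag_mx (\row_k Pf^`().[x k])) (map_mx f Sur)
             0 (map_mx f Sdr).
  rewrite /S map_block_mx mulmx_block !mulmx1 !mulmx0 !add0r; congr block_mx.
  - apply/matrixP => i k; rewrite mul_mx_diag !mxE.
    rewrite -[RHS](_ : (map_poly f ('X^i * P^`())).[x k] = _); last first.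
      by rewrite rmorphM /= map_polyXn hornerM hornerXn deriv_map.
    rewrite -ev; last by apply: leq_trans (szX _ i _ sP') _; rewrite leq_add2l -ltnS.
    by congr (_ + _); apply: eq_bigr => j _; rewrite !mxE.
  - apply/matrixP => i k; rewrite !mxE.
    transitivity ((map_poly f ('X^i * P)).[x k]).
      rewrite -ev; last first.
        apply: leq_trans (szX _ i n.+2 _) _; first by rewrite sP.
        by rewrite addSnnS leq_add2l.
      by congr (_ + _); apply: eq_bigr => j _; rewrite !mxE.
    by rewrite rmorphM /= hornerM (rootP (rx k)) mulr0.
have V0 : \det V != 0.
  rewrite det_Vandermonde; apply/prodf_neq0 => i _; apply/prodf_neq0 => j ij.
  by rewrite !mxE subr_eq0; apply: contraTneq ij => /injx ->; rewrite ltnn.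
(* Entry [(i, j)] of [Sdr] is the coefficient of [P] of degree [n.+1 + j - i]: zero above the
   diagonal, leading on it. *)
have detr : \det (map_mx f Sdr) = (lead_coef P)%:~R ^+ n.
  rewrite det_trig.
    rewrite (eq_bigr (fun=> (lead_coef P)%:~R)) ?prodr_const ?card_ord // => i _.
    rewrite !mxE coefXnM lead_coefE sP /= ltnNge.
    by rewrite (leq_trans _ (leq_addl _ _)) //= addnK.
  apply/is_trig_mxP => i j ij; rewrite !mxE coefXnM.
  rewrite ltnNge (leq_trans (ltnW ij) (leq_addl _ _)) /=.
  by rewrite nth_default // sP -addnBA ?(ltnW ij) // -[n.+2]addn1 leq_add2l subn_gt0.
(* In the determinants of [prodE] the nonzero Vandermonde factor occurs on both sides and
   cancels. *)
exists (\det S).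
have := congr1 determinant prodE.
rewrite det_mulmx det_lblock det1 mulr1 det_ublock det_mulmx det_diag detr.
rewrite (_ : \det (map_mx f S) = (\det S)%:~R) ?det_map_mx //.
under [X in _ = _ * X * _]eq_bigr do rewrite mxE.
rewrite -mulrA [X in X = _]mulrC => /(mulfI V0) ->.
by rewrite mulrC.
Qed.

(** * Logarithmic kernels in the unit disk *)

Section complex_modulus.
Context {R : rcfType}.
Implicit Types (u z w : R[i]) (r : R).

Lemma normc_real z : (normc z)%:C = `|z|. Proof. by []. Qed.

Lemma normc_ge0 z : 0 <= normc z. Proof. by rewrite -ler0c normc_real. Qed.

Lemma normc_le1 z : (normc z <= 1) = (`|z| <= 1).
Proof. by rewrite -normc_real -lecR. Qed.

Lemma normc_eq0 z : (normc z == 0) = (z == 0).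
Proof.
by apply/eqP/eqP => [/eq0_normc//|->]; exact: normc0.
Qed.

Lemma normc_gt0 z : (0 < normc z) = (z != 0).
Proof. by rewrite lt_def normc_ge0 andbT normc_eq0. Qed.

Lemma normcRe_sqr z : normc z ^+ 2 = Re z ^+ 2 + complex.Im z ^+ 2.
Proof. by case: z => a b /=; rewrite sqr_sqrtr // addr_ge0 ?sqr_ge0. Qed.

Lemma normcX z m : normc (z ^+ m) = normc z ^+ m.
Proof.
elim: m => [|m IH]; first by rewrite !expr0 normc1.
by rewrite !exprS normcM IH.
Qed.

Lemma normc_conj z : normc z^* = normc z.
Proof. by case: z => a b /=; rewrite sqrrN. Qed.

Lemma normc_r r : normc r%:C = `|r|.
Proof. by rewrite /= expr0n addr0 sqrtr_sqr. Qed.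

Lemma normc_Re z : `|Re z| <= normc z.
Proof.
case: z => a b /=; rewrite -sqrtr_sqr ler_wsqrtr //.
by rewrite lerDl sqr_ge0.
Qed.

Lemma ReD z w : Re (z + w) = Re z + Re w.
Proof. by case: z w => a b [c d]. Qed.

Lemma Re_sum (I : Type) (s : seq I) (p : pred I) (F : I -> R[i]) :
  Re (\sum_(i <- s | p i) F i) = \sum_(i <- s | p i) Re (F i).
Proof. by apply: (big_morph _ ReD). Qed.

Lemma ReZ r z : Re (r%:C * z) = r * Re z.
Proof. by case: z => a b /=; rewrite mul0r subr0. Qed.

Lemma normc_sum_le (I : Type) (s : seq I) (F : I -> R[i]) :
  normc (\sum_(i <- s) F i) <= \sum_(i <- s) normc (F i).
Proof.
elim: s => [|i s IH]; first by rewrite !big_nil normc0.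
by rewrite !big_cons (le_trans (le_normcD _ _)) // lerD2l.
Qed.

Lemma conjcX z m : (z ^+ m)^* = z^* ^+ m.
Proof. exact: rmorphXn. Qed.

Lemma normc_mulJ z : z * z^* = (normc z ^+ 2)%:C.
Proof. by rewrite -sqr_normc -normc_real rmorphXn. Qed.

Lemma invcE z : z^-1 = ((normc z ^+ 2)^-1)%:C * z^*.
Proof. by rewrite invc_norm -normc_real -rmorphXn -fmorphV. Qed.

(* The two sides differ in square by [(1 - |z|^2) (1 - |w|^2)]. *)
Lemma normc_sub_le z w : normc z <= 1 -> normc w <= 1 ->
  normc (z - w) <= normc (1 - z * w^*).
Proof.
move=> z1 w1; rewrite -ler_sqr ?nnegrE ?normc_ge0 // -subr_ge0.
have z2 : 0 <= 1 - normc z ^+ 2 by rewrite subr_ge0 exprn_ile1 ?normc_ge0.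
have w2 : 0 <= 1 - normc w ^+ 2 by rewrite subr_ge0 exprn_ile1 ?normc_ge0.
have := mulr_ge0 z2 w2; rewrite !normcRe_sqr.
case: z w {z1 w1 z2 w2} => a b [c d] /= h.
by congr (0 <= _): h; ring.
Qed.

Lemma normc_1B_sqr u r :
  normc (1 - r%:C * u) ^+ 2 = 1 - 2 * r * Re u + r ^+ 2 * normc u ^+ 2.
Proof. by rewrite !normcRe_sqr; case: u => a b /=; ring. Qed.

(** For fixed [|u|] the difference of the squares does not decrease with [Re u], and in the worst
    case [u = - |u|] it factors. *)
Lemma normc_1Br u r : normc u <= 1 -> 0 <= r <= 1 ->
  (1 + r) / 2 * normc (1 - u) <= normc (1 - r%:C * u).
Proof.
move=> u1 /andP[r0 r1].
have h0 : 0 <= (1 + r) / 2 by lra.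
rewrite -ler_sqr ?nnegrE ?(mulr_ge0 h0) ?normc_ge0 // exprMn.
have u2 : normc u ^+ 2 <= 1 by rewrite exprn_ile1 ?normc_ge0.
have ua : - normc u <= Re u.
  by rewrite lerNl (le_trans _ (normc_Re u)) // -normrN ler_norm.
have := normc_1B_sqr u 1; rewrite mul1r => ->; rewrite normc_1B_sqr.
have := normc_ge0 u; move: (normc u) (Re u) u1 u2 ua => s a s1 s2 sa s0.
(* The difference of the squares is half of the quantity in [c1], the gain over the worst case
   [a = - s], plus a quarter of the one in [c2], the value there. *)
have c1 : 0 <= (1 - r) ^+ 2 * (a + s) by rewrite mulr_ge0 ?sqr_ge0 //; lra.
have c2 : 0 <= (1 - r) * (1 - s) * (3 + r + (1 + 3 * r) * s).
  rewrite !mulr_ge0 //; try lra.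
  by have := mulr_ge0 (_ : 0 <= 1 + 3 * r) s0; lra.
nra.
Qed.

Lemma normc_1B_ge u r : normc u <= 1 -> 0 <= r -> 1 - r <= normc (1 - r%:C * u).
Proof.
move=> u1 r0.
have := le_normcD (1 - r%:C * u) (r%:C * u).
rewrite subrK normc1 normcM normc_r ger0_norm //.
by have := ler_wpM2l r0 u1; lra.
Qed.

End complex_modulus.

(** * Truncated power series of the logarithmic kernel *)

Section log_series.
Context {R : realType}.

Lemma ln_normc (z : R[i]) : z != 0 -> ln (normc z) = 2^-1 * ln (normc z ^+ 2).
Proof.
by move=> z0; rewrite lnXn ?normc_gt0 //; field.
Qed.

(** Integrated geometric series: the [t]-derivative of [- ln |1 - t u|] minus that of the partial
    sum is the real part of [(t u)^N u / (1 - t u)], at most [r^N / (1 - r)] in modulus. The mean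
    value theorem on [[0, r]] concludes. *)
Lemma ln_normc_1B (u : R[i]) (r : R) N : normc u <= 1 -> 0 <= r < 1 ->
  \sum_(m < N) r ^+ m.+1 / m.+1%:R * Re (u ^+ m.+1) - r ^+ N / (1 - r)
  <= - ln (normc (1 - r%:C * u)).
Proof.
move=> u1 /andP[r0 r1].
have u2 : normc u ^+ 2 <= 1 by rewrite exprn_ile1 ?normc_ge0.
(* [|1 - t u|^2] is a real polynomial in [t], so real calculus is enough to differentiate its
   logarithm. *)
pose Q : {poly R} := 1 - (2 * Re u) *: 'X + (normc u ^+ 2) *: 'X^2.
pose T : {poly R} := \sum_(m < N) (Re (u ^+ m.+1) / m.+1%:R) *: 'X^(m.+1).
have QE t : Q.[t] = normc (1 - t%:C * u) ^+ 2.
  rewrite normc_1B_sqr /Q !hornerE /=; ring.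
have nz t : 0 <= t -> t <= r -> 1 - t%:C * u != 0.
  by move=> t0 tr; rewrite -normc_gt0 (lt_le_trans _ (normc_1B_ge u1 t0)) //
    subr_gt0 (le_lt_trans tr).
have Q0 t : 0 <= t -> t <= r -> 0 < Q.[t].
  by move=> t0 tr; rewrite QE exprn_gt0 // normc_gt0 nz.
have T'E t : T^`().[t] = \sum_(m < N) Re (t%:C ^+ m * u ^+ m.+1).
  rewrite /T raddf_sum /= horner_sum; apply: eq_bigr => m _.
  rewrite derivZ derivXn hornerZ hornerMn hornerXn -rmorphXn ReZ.
  by rewrite -[t ^+ _ *+ _]mulr_natr mulrCA; congr (_ * _); rewrite mulfVK ?pnatr_eq0.
have Q'E t : Q^`().[t] = - 2 * (Re u - t * normc u ^+ 2).
  rewrite /Q derivD derivB derivC !derivZ derivX derivXn !hornerE /=. ring.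
pose G (t : R) : R := - (2^-1 * ln Q.[t]) - T.[t].
pose dG t := (Re u - t * normc u ^+ 2) / Q.[t] - T^`().[t].
have dGE t : 0 <= t -> t <= r -> is_derive t 1 G (dG t).
  move=> t0 tr.
  have dQ := is_derive_poly Q t.
  have dl := is_derive1_ln (Q0 t t0 tr).
  have dT := is_derive_poly T t.
  have dc := @is_derive1_comp R (@ln R) (horner Q) t _ _ dl dQ.
  have -> : G = (- (2^-1 \*: ((@ln R) \o horner Q))) - (horner T) by apply/funext.
  apply: is_derive_eq.
  rewrite Q'E /dG /=; congr (_ - _).
  rewrite /GRing.scale /=.
  have := Q0 t t0 tr; move=> /lt0r_neq0 q0; field; exact: q0.
have dGge t : 0 <= t -> t <= r -> - (r ^+ N / (1 - r)) <= dG t.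
  move=> t0 tr.
  have geo : u / (1 - t%:C * u) - \sum_(m < N) t%:C ^+ m * u ^+ m.+1 =
      (t%:C * u) ^+ N * u / (1 - t%:C * u).
    under eq_bigr => m _ do rewrite exprSr mulrA -exprMn.
    rewrite -mulr_suml; have := subrX1 (t%:C * u) N.
    have := nz t t0 tr; move: (\sum_(i < N) _) => S; move: (t%:C * u) => v v0 E.
    have -> : S = (1 - v ^+ N) / (1 - v).
      by apply: (mulIf v0); rewrite mulfVK // -[RHS]opprB E; ring.
    by field.
  have -> : dG t = Re ((t%:C * u) ^+ N * u / (1 - t%:C * u)).
    rewrite -geo ReD /dG T'E; congr (_ + _); last first.
      by rewrite -Re_sum; case: (\sum_(i < N) _).
    rewrite QE invcE [u * (_ * _)]mulrCA ReZ mulrC; congr (_ * _).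
    by rewrite normcRe_sqr; case: (u) => p q /=; ring.
  rewrite lerNl; apply: le_trans (_ : normc ((t%:C * u) ^+ N * u / (1 - t%:C * u)) <= _).
    by apply: le_trans (normc_Re _); rewrite -normrN ler_norm.
  rewrite !normcM normcV normcX normcM normc_r.
  rewrite ger0_norm //; apply: ler_pM => //.
  - by rewrite mulr_ge0 ?normc_ge0 // exprn_ge0 ?mulr_ge0 ?normc_ge0.
  - by rewrite invr_ge0 normc_ge0.
  - rewrite -[leRHS]mulr1 ler_pM ?normc_ge0 ?exprn_ge0 ?mulr_ge0 ?normc_ge0 //.
    by rewrite lerXn2r ?nnegrE ?mulr_ge0 ?normc_ge0 // -[leRHS]mulr1 ler_pM ?normc_ge0.
  - rewrite lef_pV2 ?posrE ?subr_gt0 ?normc_gt0 ?nz //.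
    by apply: le_trans (normc_1B_ge u1 t0); rewrite lerB.
have [x /[!in_itv]/= /andP[x0 xr]] :
    exists2 c, c \in `[0, r]%R & G r - G 0 = dG c * (r - 0).
  apply: (@MVT_segment _ G dG 0 r r0) => [x|].
    by rewrite in_itv /= => /andP[x0 xr]; apply: dGE; exact: ltW.
  apply: derivable_within_continuous => x; rewrite in_itv /= => /andP[x0 xr].
  by have [] := dGE x x0 xr.
rewrite subr0 => E.
have G0 : G 0 = 0.
  rewrite /G QE mul0r subr0 normc1 expr1n ln1 mulr0 oppr0 sub0r.
  rewrite /T horner_sum big1 ?oppr0 // => m _.
  by rewrite !hornerE /= expr0n mulr0.
have Gr : G r = - ln (normc (1 - r%:C * u)) -
    \sum_(m < N) r ^+ m.+1 / m.+1%:R * Re (u ^+ m.+1).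
  rewrite /G QE -ln_normc ?nz //; congr (_ - _).
  rewrite /T horner_sum; apply: eq_bigr => m _.
  by rewrite !hornerE /=; ring.
move: E; rewrite G0 subr0 Gr => E.
have K0 : 0 <= r ^+ N / (1 - r) by rewrite divr_ge0 ?exprn_ge0 // subr_ge0 ltW.
have := dGge x x0 xr; set K := r ^+ N / (1 - r) in K0 *; move: (dG x) E => d E dK.
have : - K <= d * r by nra.
rewrite -E; lra.
Qed.

End log_series.

(** * Energy and power sums of the zeros *)

Section ln_facts.
Context {R : realType}.

Lemma ln_prod (I : Type) (s : seq I) (p : pred I) (F : I -> R) :
  (forall i, p i -> 0 < F i) ->
  ln (\prod_(i <- s | p i) F i) = \sum_(i <- s | p i) ln (F i).
Proof.
move=> F0; elim: s => [|i s IH]; first by rewrite !big_nil ln1.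
rewrite !big_cons; case: ifP => // pi.
by rewrite lnM ?posrE ?IH ?F0 // prodr_gt0.
Qed.

Lemma ln_le_subr1 (x : R) : 0 < x -> ln x <= x - 1.
Proof.
by move=> x0; rewrite -[in leLHS](subrK 1 x) addrC;
  apply: le_ln1Dx; rewrite ltrBrDr addNr.
Qed.

Lemma normc_prod (I : Type) (s : seq I) (p : pred I) (F : I -> R[i]) :
  normc (\prod_(i <- s | p i) F i) = \prod_(i <- s | p i) normc (F i).
Proof.
exact: (big_morph _ (@normcM R) (normc1 R)).
Qed.

Lemma normc_int_ge1 (d : int) : d%:~R != 0 :> R[i] -> 1 <= normc (d%:~R : R[i]).
Proof.
rewrite intr_eq0 -(rmorph_int (real_complex R)) normc_r -intr_norm => d0.
by rewrite -[1]/(1%:~R) ler_int -gtz0_ge1 normr_gt0.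
Qed.

End ln_facts.

Lemma deriv_prod_XsubC_root (F : comNzRingType) n (x : 'I_n -> F) (c : F) k :
  (c *: \prod_j ('X - (x j)%:P))^`().[x k] = c * \prod_(j | j != k) (x k - x j).
Proof.
rewrite derivZ hornerZ (bigD1 k) //= derivM derivXsubC mul1r hornerD hornerM.
rewrite hornerXsubC subrr mul0r addr0 horner_prod; congr (_ * _).
by apply: eq_bigr => j _; rewrite hornerXsubC.
Qed.

(** * Consequences of integrality of the coefficients *)

Section integer_polynomial.
Context {R : realType}.
Variables (n : nat) (P : {poly int}) (a : int) (x : 'I_n -> R[i]) (M : R).
Hypothesis sP : size P = n.+1.
Hypothesis PE : map_poly intr P = a%:~R *: \prod_(k < n) ('X - (x k)%:P).
Hypothesis injx : injective x.
Hypothesis aM : `|a%:~R| <= M.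

Let lead_coefP : (lead_coef P)%:~R = a%:~R :> R[i].
Proof.
rewrite -[LHS](@lead_coef_map_eq _ _ intr P) ?intr_eq0
  ?lead_coef_eq0 -?size_poly_eq0 ?sP //.
by rewrite PE lead_coefZ (monicP _) ?mulr1 // monic_prod_XsubC.
Qed.

Let a_neq0 : a%:~R != 0 :> R[i].
Proof. by rewrite -lead_coefP intr_eq0 lead_coef_eq0 -size_poly_eq0 sP. Qed.

Let normc_a : normc (a%:~R : R[i]) = `|a%:~R|.
Proof. by rewrite -(rmorph_int (real_complex R)) normc_r. Qed.

Lemma leading_bound_ge1 : 1 <= M.
Proof. by apply: le_trans aM; rewrite -normc_a normc_int_ge1. Qed.

Let lnA0 : 0 <= ln (normc (a%:~R : R[i])).
Proof. by rewrite ln_ge0 // normc_int_ge1. Qed.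

Let lnAM : ln (normc (a%:~R : R[i])) <= ln M.
Proof.
have M1 := leading_bound_ge1.
by rewrite ler_ln ?posrE ?normc_gt0 ?normc_a // (lt_le_trans _ M1).
Qed.

(** The integer given by [int_discriminant] has modulus [|a|^(2n - 1)] times the product of all
    [|x_k - x_j|]. It is nonzero because the zeros are distinct, hence of modulus at least 1; take
    logarithms. *)
Lemma log_energy_le :
  \sum_k \sum_(j | j != k) - ln (normc (x k - x j)) <= 2 * n%:R * ln M.
Proof.
(* [int_discriminant] is stated for [m.+1] roots; for [n = 0] both sides vanish. *)
case: n P x sP PE injx lead_coefP => [|m] Q y sQ QE injy lcQ.
  by rewrite big_ord0 mulr0 mul0r.
have ry k : root (map_poly intr Q) (y k).
  apply/rootP; rewrite QE hornerZ horner_prod (bigD1 k) //= hornerXsubC subrr.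
  by rewrite mul0r mulr0.
have [d dE] := int_discriminant sQ ry injy.
have dy j k : j != k -> y k - y j != 0.
  by move=> jk; rewrite subr_eq0 (inj_eq injy) eq_sym.
pose A := normc (a%:~R : R[i]).
have A0 : 0 < A by rewrite normc_gt0.
have p0 k : 0 < \prod_(j | j != k) normc (y k - y j).
  by apply: prodr_gt0 => j jk; rewrite normc_gt0 dy.
have dn : normc (d%:~R : R[i]) =
      A ^+ m * \prod_k (A * \prod_(j | j != k) normc (y k - y j)).
  rewrite dE lcQ normcM normcX normc_prod; congr (_ * _).
  apply: eq_bigr => k _.
  by rewrite QE deriv_prod_XsubC_root normcM normc_prod.
have pp : 0 < \prod_k (A * \prod_(j | j != k) normc (y k - y j)).
  by apply: prodr_gt0 => k _; rewrite mulr_gt0.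
have : 1 <= normc (d%:~R : R[i]).
  by apply: normc_int_ge1; rewrite -normc_eq0 dn gt_eqF // mulr_gt0 ?exprn_gt0.
move=> /ln_ge0; rewrite dn lnM ?posrE ?exprn_gt0 // lnXn // ln_prod; last first.
  by move=> k _; rewrite mulr_gt0.
rewrite (eq_bigr (fun k => ln A + \sum_(j | j != k) ln (normc (y k - y j)))); last first.
  move=> k _; rewrite lnM ?posrE // ln_prod // => j jk.
  by rewrite normc_gt0 dy.
rewrite big_split /= sumr_const card_ord => h.
under eq_bigr do rewrite sumrN.
rewrite sumrN; move: h; rewrite -[_ *+ m]mulr_natl -[_ *+ m.+1]mulr_natl.
have := lnA0; have := lnAM; rewrite -/A => hAM hA0.
have m0 : 0 <= m%:R :> R by [].
rewrite -natr1; have := ler_wpM2l m0 hAM.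
nra.
Qed.

(** The lowest nonzero coefficient is [a] times the product of [- x k] over the nonzero zeros, and
    [1 - t <= - ln t] turns the resulting bound on a product into one on a sum. The origin is a zero
    at most once, which costs the extra 1. *)
Lemma sum_1Bnormc_le : (forall k, normc (x k) <= 1) ->
  \sum_k (1 - normc (x k)) <= 1 + ln M.
Proof.
move=> x1.
have key (p : pred 'I_n) d : (forall k, p k -> x k != 0) ->
    d%:~R = a%:~R * \prod_(k | p k) - x k ->
    \sum_(k | p k) (1 - normc (x k)) <= ln M.
  move=> px dE.
  have xp k : p k -> 0 < normc (x k) by move=> /px; rewrite normc_gt0.
  have pp : 0 < \prod_(k | p k) normc (x k) by exact: prodr_gt0.
  have dn : normc (d%:~R : R[i]) = normc (a%:~R : R[i]) * \prod_(k | p k) normc (x k).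
    rewrite dE normcM normc_prod; congr (_ * _).
    by apply: eq_bigr => k _; rewrite normcN.
  have : 1 <= normc (d%:~R : R[i]).
    by apply: normc_int_ge1; rewrite -normc_eq0 dn gt_eqF // mulr_gt0 ?normc_gt0.
  move=> /ln_ge0; rewrite dn lnM ?posrE ?normc_gt0 // ln_prod // => h.
  have : \sum_(k | p k) ln (normc (x k)) <= \sum_(k | p k) (normc (x k) - 1).
    by apply: ler_sum => k pk; exact/ln_le_subr1/xp.
  have -> : \sum_(k | p k) (1 - normc (x k)) = - \sum_(k | p k) (normc (x k) - 1).
    by rewrite -sumrN; apply: eq_bigr => k _; rewrite opprB.
  by have := lnAM; lra.
have M0 : 0 <= ln M by exact/ln_ge0/leading_bound_ge1.
have [/existsP[k0 /eqP xk0]|/existsPn h] := boolP [exists k, x k == 0]; last first.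
  apply: le_trans (key xpredT P`_0 _ _) _ => //; last by rewrite lerDr.
  rewrite -(coef_map intr) PE coefZ; congr (_ * _).
  rewrite -horner_coef0 horner_prod; apply: eq_bigr => k _.
  by rewrite hornerXsubC sub0r.
rewrite (bigD1 k0) //=; apply: lerD.
  by rewrite lerBlDr lerDl normc_ge0.
(* With a simple zero at the origin, the lowest nonzero coefficient is the value of the derivative
   there. *)
apply: (key (fun k => k != k0) P^`()`_0) => [k|].
  by rewrite -xk0 (inj_eq injx).
rewrite -(coef_map intr) -horner_coef0 -deriv_map PE -[in LHS]xk0.
rewrite deriv_prod_XsubC_root; congr (_ * _).
by apply: eq_bigr => k _; rewrite xk0 sub0r.
Qed.

End integer_polynomial.

(** * From the logarithmic energy to power sums *)

Section power_sums.
Context {R : realType}.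
Variables (n : nat) (x : 'I_n -> R[i]) (L : R).
Hypothesis injx : injective x.
Hypothesis x1 : forall k, normc (x k) <= 1.
Hypothesis energy :
  \sum_k \sum_(j | j != k) - ln (normc (x k - x j)) <= 2 * n%:R * L.

Let normc_xx k j : normc (x k * (x j)^*) <= 1.
Proof.
by rewrite normcM normc_conj -[leRHS]mulr1 ler_pM ?normc_ge0.
Qed.

(** Off the diagonal, replacing [|x_k - x_j|] by the smoothed kernel costs at most
    [ln (2 / (1 + r)) <= 1 - r] for each of at most [n^2] pairs. Each diagonal term, infinite
    without smoothing, is now at most [- ln (1 - r)]. *)
Lemma regularized_energy_le r : 0 <= r < 1 ->
  \sum_k \sum_j - ln (normc (1 - r%:C * (x k * (x j)^*))) <=
  n%:R * (2 * L - ln (1 - r)) + n%:R ^+ 2 * (1 - r).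
Proof.
move=> /andP[r0 r1].
have br0 : 0 < 1 - r by rewrite subr_gt0.
have offd k j : j != k ->
    - ln (normc (1 - r%:C * (x k * (x j)^*))) <=
    - ln (normc (x k - x j)) + (1 - r).
  move=> jk.
  have s0 : 0 < normc (x k - x j) by rewrite normc_gt0 subr_eq0 (inj_eq injx) eq_sym.
  have h0 : 0 < (1 + r) / 2 by lra.
  have lekj : (1 + r) / 2 * normc (x k - x j) <=
      normc (1 - r%:C * (x k * (x j)^*)).
    have rr : 0 <= r <= 1 by rewrite r0 ltW.
    apply: le_trans (normc_1Br (normc_xx k j) rr).
    by rewrite ler_wpM2l ?(ltW h0) // normc_sub_le.
  have l0 : 0 < (1 + r) / 2 * normc (x k - x j) by rewrite mulr_gt0.
  have l1 := lt_le_trans l0 lekj.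
  move: lekj; rewrite -(@ler_ln R _ _ l0 l1) lnM ?posrE // => lekj.
  have hv : 0 < 2 / (1 + r) by rewrite divr_gt0; lra.
  have := ln_le_subr1 hv.
  rewrite -invf_div lnV ?posrE // invf_div.
  have : 2 / (1 + r) - 1 <= 1 - r.
    have -> : 2 / (1 + r) - 1 = (1 - r) / (1 + r) by field; lra.
    by rewrite ler_pdivrMr; nra.
  by lra.
have diag k : - ln (normc (1 - r%:C * (x k * (x k)^*))) <= - ln (1 - r).
  rewrite lerN2 ler_ln ?posrE ?normc_1B_ge //.
  by rewrite (lt_le_trans br0) // normc_1B_ge.
apply: (@le_trans _ _ (\sum_(k < n) (- ln (1 - r) +
    \sum_(j < n | j != k) (- ln (normc (x k - x j)) + (1 - r))))).
  apply: ler_sum => k _; rewrite (bigD1 k) //=; apply: lerD => //.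
  by apply: ler_sum => j; exact: offd.
rewrite big_split /= sumr_const card_ord.
under eq_bigr do rewrite big_split /=.
rewrite big_split /= -mulr_natl.
have : \sum_(i < n) \sum_(j < n | j != i) (1 - r) <= n%:R ^+ 2 * (1 - r).
  rewrite -[leRHS](_ : \sum_(i < n) \sum_(j < n) (1 - r) = _); last first.
    by rewrite !sumr_const !card_ord -mulrnA -[_ *+ (n * n)]mulr_natl natrM expr2.
  apply: ler_sum => k _; rewrite [leRHS](bigD1 k) //= lerDr; exact: ltW.
by move: energy; lra.
Qed.

Lemma power_sum_le m r : 0 < r < 1 ->
  normc (\sum_k x k ^+ m.+1) ^+ 2 <=
  m.+1%:R / r ^+ m.+1 * (n%:R * (2 * L - ln (1 - r)) + n%:R ^+ 2 * (1 - r)).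
Proof.
move=> /andP[r0 r1].
have r01 : 0 <= r < 1 by rewrite (ltW r0).
set E := (_ + _ : R).
pose p i := \sum_k x k ^+ i.
have pE i : \sum_k \sum_j Re ((x k * (x j)^*) ^+ i) = normc (p i) ^+ 2.
  transitivity (Re (p i * (p i)^*)); last by rewrite normc_mulJ.
  rewrite /p rmorph_sum mulr_suml Re_sum; apply: eq_bigr => k _.
  rewrite mulr_sumr Re_sum; apply: eq_bigr => j _.
  by rewrite exprMn -conjcX.
have tail N : (m < N)%N ->
    r ^+ m.+1 / m.+1%:R * normc (p m.+1) ^+ 2 <= E + n%:R ^+ 2 / (1 - r) * r ^+ N.
  move=> mN; rewrite -lerBlDr.
  apply: le_trans (regularized_energy_le r01).
  apply: (@le_trans _ _ (\sum_k \sum_j (\sum_(i < N) r ^+ i.+1 / i.+1%:R *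
      Re ((x k * (x j)^*) ^+ i.+1) - r ^+ N / (1 - r)))); last first.
    by apply: ler_sum => k _; apply: ler_sum => j _; exact: ln_normc_1B.
  under [leRHS]eq_bigr do rewrite big_split /= sumr_const card_ord.
  rewrite big_split /= sumr_const card_ord; apply: lerD; last first.
    rewrite -mulrnA -[_ *+ (n * n)]mulr_natr natrM le_eqVlt; apply/orP; left.
    by apply/eqP; ring.
  under [leRHS]eq_bigr do rewrite exchange_big /=.
  rewrite exchange_big /= (bigD1 (Ordinal mN)) //= ler_wpDr //.
    apply: sumr_ge0 => i _.
    under eq_bigr do rewrite -mulr_sumr.
    by rewrite -mulr_sumr pE mulr_ge0 ?sqr_ge0 // divr_ge0 // exprn_ge0 // ltW.
  under [leRHS]eq_bigr do rewrite -mulr_sumr.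
  by rewrite -mulr_sumr pE.
have rm : 0 < r ^+ m.+1 / m.+1%:R by rewrite divr_gt0 ?exprn_gt0.
rewrite -[m.+1%:R / _]invf_div mulrC ler_pdivlMr // mulrC.
apply/ler_addgt0Pr => e e0.
(* The added 1 keeps [c] positive even when [n = 0], so that [e / c] is a valid tolerance for
   [r^N]. *)
pose c := n%:R ^+ 2 / (1 - r) + 1.
have c0 : 0 < c by rewrite ltr_wpDl // divr_ge0 ?exprn_ge0 // subr_ge0 ltW.
have /cvgr0Pnorm_lt/(_ (e / c)) : (GRing.exp r : nat -> R) @ \oo --> 0.
  by apply: cvg_expr; rewrite ger0_norm // ltW.
move=> /(_ _)[|N0 _ hN]; first by rewrite divr_gt0.
pose N := maxn m.+1 N0.
apply: le_trans (tail N _) _; first by rewrite leq_maxl.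
rewrite lerD2l; have /= := hN N (leq_maxr _ _).
have rN : 0 <= r ^+ N by rewrite exprn_ge0 // ltW.
rewrite ger0_norm // ltr_pdivlMr // => h.
by apply: ltW; apply: le_lt_trans h; rewrite mulrC ler_wpM2l // lerDl.
Qed.

End power_sums.

(** * Integration against the circle and zero-counting measures *)

Section integrals.
Context {R : realType}.
Implicit Types (phi : R[i] -> R) (g h : R -> R).

Lemma measurable_continuousC phi : continuous phi ->
  measurable_fun [set: borelC R] (phi : borelC R -> R).
Proof.
move=> /continuousP cphi; apply: (measurability _ (RGenOpens.measurableE R)).
move=> _ [_ [a [b ->] <-]]; rewrite setTI.
by apply: sub_sigma_algebra; apply: cphi; exact: interval_open.
Qed.

Local Open Scope ereal_scope.

Lemma ge0_integral_circle (f : borelC R -> \bar R) :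
  measurable_fun setT f -> (forall z, 0 <= f z) ->
  \int[circle_measure]_z f z =
  ((2 * pi)^-1)%:E * \int[lebesgue_measure]_(t in `[0%R, (2 * pi)%R]) f (expi t).
Proof.
move=> mf f0.
pose T := measurableTypeR R.
pose D : set T := `[0%R, (2 * pi)%R]%classic.
have mD : measurable D by exact: measurable_itv.
pose mu : {measure set T -> \bar R} :=
  mrestr lebesgue_measure (measurable_itv `[0%R, (2 * pi)%R]).
pose m : {measure set T -> \bar R} := mscale (NngNum (inv_2pi_ge0 (R := R))) mu.
have mexp : measurable_fun [set: T] (expi : T -> borelC R) by exact: measurable_expi.
have mfe (A : set T) : measurable A -> measurable_fun A (f \o (expi : T -> borelC R)).
  by move=> mA; apply: measurable_funTS; exact: measurableT_comp mf mexp.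
have fi0 : {in setT, forall y, 0 <= f y} by move=> z _; exact: f0.
have E := ge0_integral_pushforward mexp m measurableT mf fi0.
rewrite [LHS]E {E}.
rewrite preimage_setT.
have E := ge0_integral_mscale mu measurableT (NngNum (inv_2pi_ge0 (R := R)))
  (mfe setT measurableT) (fun x _ => f0 (expi x)).
rewrite [LHS]E {E}.
congr (_ * _).
(* The restricted measure has no mass off [D] and agrees with Lebesgue measure on subsets of [D]. *)
rewrite -(setUv D) ge0_integral_setU; last 5 first.
- exact: mD.
- exact: (measurableC mD).
- by rewrite setUv; exact: (mfe setT measurableT).
- by move=> t _; exact: f0.
- exact/disj_setPCl.
have mDC : measurable (~` D) by exact: measurableC.
have E : \int[mu]_(t in ~` D) (f \o expi) t = 0.
  apply: null_set_integral => //; first exact: mfe.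
  by rewrite /mu /= /mrestr setICl measure0.
rewrite [X in _ + X]E adde0 {E}.
by apply: eq_measure_integral => A mA AD; rewrite /mu /= /mrestr setIidl.
Qed.

Lemma ge0_integral_counting n (s : n.-tuple R[i]) (f : borelC R -> \bar R) :
  measurable_fun setT f -> (forall z, 0 <= f z) ->
  \int[zero_counting s]_z f z = (n%:R^-1)%:E * \sum_(k < n) f (tnth s k).
Proof.
move=> mf f0.
have E := ge0_integral_mscale (msum (fun k => \d_(s`_k : borelC R)) n)
  measurableT ((n%:R^-1)%:nng)%R mf (fun x _ => f0 x).
rewrite [LHS]E {E} ge0_integral_measure_sum //; congr (_ * _).
apply: eq_bigr => k _; rewrite integral_dirac // diracT mul1e.
by rewrite (tnth_nth 0%R).
Qed.

Local Close Scope ereal_scope.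

(** The mean over the circle in the angular variable, kept real-valued so that linearity and
    monotonicity involve no infinities. *)
Definition cmean g : R := (2 * pi)^-1 * \int[lebesgue_measure]_(t in `[0, 2 * pi]) g t.

Let mitv : measurable (`[0, 2 * pi]%classic : set (measurableTypeR R)).
Proof. exact: measurable_itv. Qed.

Let integrable_cont g : continuous g ->
  lebesgue_measure.-integrable `[0, 2 * pi] (EFin \o g).
Proof.
move=> cg; apply: continuous_compact_integrable; first exact: segment_compact.
exact: continuous_subspaceT.
Qed.

Lemma cmeanD g h : continuous g -> continuous h ->
  cmean (fun t => g t + h t) = cmean g + cmean h.
Proof.
move=> cg ch; rewrite /cmean -mulrDr; congr (_ * _).
exact: (RintegralD mitv (integrable_cont cg) (integrable_cont ch)).
Qed.

Lemma cmeanZ c g : continuous g -> cmean (fun t => c * g t) = c * cmean g.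
Proof.
move=> cg; rewrite /cmean mulrCA; congr (_ * _).
exact: (RintegralZl c mitv (integrable_cont cg)).
Qed.

Lemma cmean_cst c : cmean (fun=> c) = c.
Proof.
rewrite /cmean (Rintegral_cst _ mitv) /= lebesgue_measure_itv /= lte_fin.
have p0 : (0 : R) < 2 * pi by rewrite mulr_gt0 // pi_gt0.
by rewrite p0 /= subr0 mulrCA mulVf ?mulr1 // gt_eqF.
Qed.

Lemma le_cmean g h : continuous g -> continuous h -> (forall t, g t <= h t) ->
  cmean g <= cmean h.
Proof.
move=> cg ch gh; rewrite ler_wpM2l ?invr_ge0 ?mulr_ge0 ?pi_ge0 //.
exact: (le_Rintegral mitv (integrable_cont cg) (integrable_cont ch) (fun t _ => gh t)).
Qed.

Lemma cmean_sum (I : Type) (s : seq I) (p : pred I) (F : I -> R -> R) :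
  (forall i, continuous (F i)) ->
  cmean (fun t => \sum_(i <- s | p i) F i t) = \sum_(i <- s | p i) cmean (F i).
Proof.
move=> cF.
have cS r : continuous (fun t => \sum_(i <- r | p i) F i t).
  elim: r => [|i r IH]; first by under eq_fun do rewrite big_nil; exact: cst_continuous.
  under eq_fun do rewrite big_cons.
  case: (p i) => // t; apply: cvgD; [exact: cF|exact: IH].
elim: s => [|i s IH]; first by under eq_fun do rewrite big_nil; rewrite big_nil cmean_cst.
rewrite big_cons; under eq_fun do rewrite big_cons.
by case: ifP => _ //; rewrite cmeanD // IH.
Qed.

Lemma cmean_abs_le g c : continuous g -> (forall t, `|g t| <= c) -> `|cmean g| <= c.
Proof.
move=> cg gc; rewrite ler_norml; apply/andP; split.
  rewrite -(cmean_cst (- c)); apply: le_cmean => //; first exact: cst_continuous.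
  by move=> t; have := gc t; rewrite ler_norml => /andP[].
rewrite -(cmean_cst c); apply: le_cmean => //; first exact: cst_continuous.
by move=> t; have := gc t; rewrite ler_norml => /andP[].
Qed.

(** Fundamental theorem of calculus over one turn; it makes the nonconstant waves average to
    zero. *)
Lemma cmean_deriv g (G : R -> R) : continuous g ->
  (forall t : R, is_derive t (1 : R) G (g t)) -> G (2 * pi) = G 0 -> cmean g = 0.
Proof.
move=> cg dG Gper.
have cG : continuous G.
  by move=> t; apply/differentiable_continuous/derivable1_diffP; have [] := dG t.
rewrite /cmean /Rintegral (@continuous_FTC2 _ g G).
- by rewrite -EFinB Gper subrr mulr0.
- by rewrite mulr_gt0 // pi_gt0.
- exact: continuous_subspaceT.
- split.
  + by move=> t _; have [] := dG t.
  + by apply: cvg_at_right_filter; exact: cG.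
  + by apply: cvg_at_left_filter; exact: cG.
- by move=> t _; rewrite derive1E; have [_ ->] := dG t.
Qed.

Lemma integral_counting n (s : n.-tuple R[i]) phi : continuous phi ->
  (\int[zero_counting s]_z (phi z)%:E)%E =
  (n%:R^-1 * \sum_(k < n) phi (tnth s k))%:E.
Proof.
move=> cphi; have mphi := measurable_continuousC cphi.
have mE : measurable_fun [set: borelC R] (EFin \o phi) by exact/measurable_EFinP.
rewrite integralE ge0_integral_counting //; last exact: measurable_funepos.
rewrite ge0_integral_counting //; last exact: measurable_funeneg.
rewrite funerpos funerneg /= !sumEFin -!EFinM -EFinB -mulrBr -sumrB.
congr ((_ * _)%:E); apply: eq_bigr => k _ /=.
exact: (congr1 (@^~ (tnth s k)) (funrposBneg phi)).
Qed.

Lemma integral_circle phi : continuous phi ->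
  (\int[circle_measure]_z (phi z)%:E)%E = (cmean (phi \o expi))%:E.
Proof.
move=> cphi; have mphi := measurable_continuousC cphi.
have mE : measurable_fun [set: borelC R] (EFin \o phi) by exact/measurable_EFinP.
have cpe : continuous (phi \o expi : R -> R).
  by move=> t; apply: continuous_comp; [exact: continuous_expi|exact: cphi].
have ipe : lebesgue_measure.-integrable `[0, 2 * pi] ((EFin \o phi) \o expi) :=
  integrable_cont cpe.
have E := @integralE _ _ _ lebesgue_measure `[0, 2 * pi] ((EFin \o phi) \o expi).
(* Integrability excludes a difference of two infinities, so the factor [1 / (2 pi)] distributes
   over positive and negative parts. *)
have AD := integrable_add_def mitv ipe.
rewrite funepos_comp funeneg_comp in E AD.
rewrite integralE ge0_integral_circle //; last exact: measurable_funepos.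
rewrite ge0_integral_circle //; last exact: measurable_funeneg.
rewrite -[LHS](@muleBr _ ((2 * pi)^-1)%:E _ _ isT AD) -E.
rewrite /cmean /Rintegral EFinM fineK //.
exact: (integrable_fin_num mitv (integrable_cont cpe)).
Qed.

End integrals.

(** * Fejer kernels *)

Section Fejer.
Context {R : realType}.
Implicit Types (z w c : R[i]) (t : R).

Lemma normc_expi t : normc (expi t : R[i]) = 1.
Proof. by rewrite /= cos2Dsin2 sqrtr1. Qed.

Lemma expiX t m : (expi t : R[i]) ^+ m = expi (m%:R * t).
Proof.
elim: m => [|m IH]; first by rewrite expr0 mul0r /expi cos0 sin0.
rewrite exprS IH /expi -natr1 mulrDl mul1r addrC cosD sinD; simpc.
by congr (_ +i* _); ring.
Qed.

Lemma cos_sin_2piM m :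
  cos (m%:R * (2 * pi) : R) = 1 /\ sin (m%:R * (2 * pi) : R) = 0.
Proof.
have -> : m%:R * (2 * pi) = 0 + (pi *+ 2) *+ m :> R.
  by rewrite add0r !mulr_natl.
rewrite (periodicn (@cosD2pi R)) (periodicn (@sinD2pi R)) cos0 sin0 //.
Qed.

(** The real part of [c e^(i (l - j) t)], with [j] and [l] kept apart to match the terms of an
    expanded squared modulus. *)
Definition wave c (j l : nat) t : R :=
  Re (c * ((expi t : R[i])^* ^+ j * (expi t : R[i]) ^+ l)).

Lemma waveE c j l t : wave c j l t =
  Re c * cos ((l%:R - j%:R) * t) - complex.Im c * sin ((l%:R - j%:R) * t).
Proof.
rewrite /wave -conjcX !expiX mulrBl cosB sinB /expi; case: c => a b; simpc => /=.
ring.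
Qed.

Lemma continuous_wave c j l : continuous (wave c j l).
Proof.
have -> : wave c j l = (fun t => Re c * cos ((l%:R - j%:R) * t) -
    complex.Im c * sin ((l%:R - j%:R) * t)).
  by apply/funext => t; exact: waveE.
move=> t; apply: cvgB; apply: cvgMl_tmp.
  apply: (@continuous_comp _ _ _ (fun t => (l%:R - j%:R) * t) cos).
    exact: mulrl_continuous.
  exact: continuous_cos.
apply: (@continuous_comp _ _ _ (fun t => (l%:R - j%:R) * t) sin).
  exact: mulrl_continuous.
exact: continuous_sin.
Qed.

Lemma cmean_wave c j l : cmean (wave c j l) = if j == l then Re c else 0.
Proof.
case: eqVneq => [->|jl].
  rewrite -[RHS]cmean_cst; congr cmean; apply/funext => t.
  by rewrite waveE subrr mul0r cos0 sin0 mulr1 mulr0 subr0.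
set s : R := l%:R - j%:R.
have s0 : s != 0 by rewrite subr_eq0 eqr_nat eq_sym.
(* An explicit primitive of the wave, taking equal values at 0 and [2 pi] because [s] is a
   difference of integers. *)
pose G t := s^-1 * (Re c * sin (s * t) + complex.Im c * cos (s * t)).
apply: (@cmean_deriv _ _ G); first exact: continuous_wave.
  move=> t.
  have ds : is_derive t (1 : R) (fun t : R => s * t) s.
    have -> : (fun t : R => s * t) = s \*: (@id R) by [].
    by apply: is_derive_eq; rewrite /GRing.scale /= mulr1.
  have dsin :=
    @is_derive1_comp R (@sin R) (fun t : R => s * t) t _ _ (is_derive_sin _) ds.
  have dcos :=
    @is_derive1_comp R (@cos R) (fun t : R => s * t) t _ _ (is_derive_cos _) ds.
  have -> : G = s^-1 \*: (Re c \*: (@sin R \o (fun t : R => s * t)) +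
      complex.Im c \*: (@cos R \o (fun t : R => s * t))) by [].
  apply: is_derive_eq; rewrite waveE -/s /GRing.scale /=.
  by field.
rewrite /G mulr0 cos0 sin0 mulrBl cosB sinB.
have [-> ->] := cos_sin_2piM l; have [-> ->] := cos_sin_2piM j.
congr (_ * _); ring.
Qed.

(** This is [N^-1 |sum_(j < N) (z e^(- i t))^j|^2]: the Fejer kernel when [|z| = 1], extended to
    other [z] as a polynomial in [z] and its conjugate. In expanded form, means over [t] and sums
    over zeros act term by term. *)
Definition fejer N z t : R :=
  N%:R^-1 * \sum_(j < N) \sum_(l < N) wave (z ^+ j * z^* ^+ l) j l t.

Lemma fejerE N z t :
  fejer N z t = N%:R^-1 * normc (\sum_(j < N) (z * (expi t : R[i])^*) ^+ j) ^+ 2.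
Proof.
rewrite /fejer; congr (_ * _); set S := (X in normc X).
transitivity (Re (S * S^*)); last by rewrite normc_mulJ.
rewrite /S rmorph_sum mulr_suml Re_sum; apply: eq_bigr => j _.
rewrite mulr_sumr Re_sum; apply: eq_bigr => l _; rewrite /wave; congr Re.
by rewrite rmorphXn rmorphM /= conjCK !exprMn mulrACA.
Qed.

Lemma fejer_ge0 N z t : 0 <= fejer N z t.
Proof. by rewrite fejerE mulr_ge0 ?sqr_ge0 // invr_ge0. Qed.

Lemma continuous_fejer N z : continuous (fejer N z).
Proof.
move=> t; apply: cvgMl_tmp; apply: cvg_big => // [|j _].
  exact: add_continuous.
apply: cvg_big => // [|l _]; first exact: add_continuous.
exact: continuous_wave.
Qed.

(** The geometric sum is [(1 - u^N) / (1 - u)] with [u = z e^(- i t)]; the numerator has modulus at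
    most 2, the denominator at least [|z - e^(i t)|]. *)
Lemma fejer_far N z t d : normc z <= 1 -> 0 < d -> d <= normc (z - expi t) ->
  fejer N z t <= 4 / (N%:R * d ^+ 2).
Proof.
move=> z1 d0 dz; rewrite fejerE invfM [leRHS]mulrCA ler_wpM2l ?invr_ge0 //.
rewrite ler_pdivlMr ?exprn_gt0 // -exprMn.
set u := z * _; set S := \sum_(j < N) u ^+ j.
have u1 : normc u <= 1.
  by rewrite normcM normc_conj normc_expi mulr1.
have du : d <= normc (1 - u).
  by apply: le_trans dz _; apply: normc_sub_le => //; rewrite normc_expi.
have E : normc (1 - u ^+ N) = normc (1 - u) * normc S.
  rewrite -normcN opprB subrX1 normcM; congr (_ * _).
  by rewrite -normcN opprB.
have : normc (1 - u ^+ N) <= 2.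
  apply: le_trans (le_normcD _ _) _.
  rewrite normcN normc1 normcX.
  by have := exprn_ile1 N (normc_ge0 u) u1; lra.
rewrite E => le2.
have -> : 4 = 2 ^+ 2 :> R by ring.
rewrite lerXn2r ?nnegrE ?mulr_ge0 ?normc_ge0 ?(ltW d0) //.
by apply: le_trans le2; rewrite mulrC ler_wpM2r ?normc_ge0.
Qed.

(** Bernoulli's inequality, with [m] then enlarged to [N]. *)
Lemma expr_1B_le (x : R) m N : 0 <= x <= 1 -> (m <= N)%N ->
  0 <= 1 - x ^+ m <= N%:R * (1 - x).
Proof.
move=> /andP[x0 x1] mN; apply/andP; split.
  by rewrite subr_ge0 exprn_ile1.
apply: (@le_trans _ _ (m%:R * (1 - x))); last first.
  by rewrite ler_wpM2r ?subr_ge0 // ler_nat.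
elim: m {mN} => [|m IH]; first by rewrite expr0 subrr mul0r.
have xm1 : x ^+ m <= 1 by exact: exprn_ile1.
have xm0 : 0 <= x ^+ m by exact: exprn_ge0.
rewrite -natr1 exprS; nra.
Qed.

(** By orthogonality of the waves only the terms [j = l] survive, so the mean is that of [|z|^(2 j)]
    over [j < N]; Bernoulli's inequality bounds its defect from 1. *)
Lemma cmean_fejer N z : (0 < N)%N -> normc z <= 1 ->
  0 <= 1 - cmean (fejer N z) <= 2 * N%:R * (1 - normc z).
Proof.
move=> N0 z1; have N0' : 0 < N%:R :> R by rewrite ltr0n.
have -> : 1 - cmean (fejer N z) = N%:R^-1 * \sum_(j < N) (1 - normc z ^+ (2 * j)).
  rewrite /fejer cmeanZ; last first.
    move=> t; apply: cvg_big => // [|j _]; first exact: add_continuous.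
    apply: cvg_big => // [|l _]; first exact: add_continuous.
    exact: continuous_wave.
  rewrite cmean_sum; last first.
    move=> j t; apply: cvg_big => // [|l _]; first exact: add_continuous.
    exact: continuous_wave.
  rewrite sumrB sumr_const card_ord mulrBr mulVf ?gt_eqF //; congr (_ - _ * _).
  apply: eq_bigr => j _; rewrite cmean_sum; last by move=> l; exact: continuous_wave.
  rewrite (bigD1 j) //= cmean_wave eqxx big1 ?addr0; last first.
    by move=> l lj; rewrite cmean_wave eq_sym (inj_eq val_inj) (negbTE lj).
  by rewrite -exprMn normc_mulJ -rmorphXn /= -exprM.
have b j : (j < N)%N -> 0 <= 1 - normc z ^+ (2 * j) <= (2 * N)%:R * (1 - normc z).
  by move=> jN; apply: expr_1B_le; rewrite ?normc_ge0 // leq_mul2l ltnW.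
apply/andP; split.
  rewrite mulr_ge0 ?invr_ge0 ?ler0n //; apply: sumr_ge0 => j _.
  by have /andP[] := b j (ltn_ord j).
rewrite ler_pdivrMl // -[leRHS](_ : \sum_(j < N) (2 * N)%:R * (1 - normc z) = _).
  by apply: ler_sum => j _; have /andP[] := b j (ltn_ord j).
by rewrite sumr_const card_ord -[LHS]mulr_natl natrM.
Qed.

Lemma continuousM_real (f g : R -> R) : continuous f -> continuous g ->
  continuous (fun t => f t * g t).
Proof. by move=> cf cg t; apply: cvgM; [exact: cf|exact: cg]. Qed.

(** The first error term is [phi z] times the mass missing from the kernel. The rest averages
    [(phi z - phi (expi t))] against the kernel: within distance [d] it is at most [e] times a mass
    at most 1, and beyond [d] at most [2 B] times the bound of [fejer_far]. *)
Lemma fejer_approx (phi : R[i] -> R) (B e d : R) N z : continuous phi ->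
  (forall z, `|phi z| <= B) -> 0 < d ->
  (forall z w, normc (z - w) < d -> `|phi z - phi w| <= e) ->
  (0 < N)%N -> normc z <= 1 ->
  `|phi z - cmean (fun t => phi (expi t) * fejer N z t)| <=
  2 * N%:R * B * (1 - normc z) + e + 8 * B / (N%:R * d ^+ 2).
Proof.
move=> cphi phiB d0 phid N0 z1.
have N0' : 0 < N%:R :> R by rewrite ltr0n.
have B0 : 0 <= B := le_trans (normr_ge0 _) (phiB 0).
have e0 : 0 <= e.
  by have := phid 0 0; rewrite subrr normc0 subrr normr0; exact.
have cpe : continuous (fun t : R => phi (expi t)).
  by move=> t; apply: continuous_comp; [exact: continuous_expi|exact: cphi].
have cF := @continuous_fejer N z.
have cpF := continuousM_real cpe cF.
have /andP[F0 F1] := cmean_fejer N0 z1.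
pose K := 8 * B / (N%:R * d ^+ 2).
have K0 : 0 <= K by rewrite divr_ge0 ?mulr_ge0 // ?sqr_ge0 // ltW.
have split_ : phi z * (1 - cmean (fejer N z)) +
    cmean (fun t => phi z * fejer N z t + - 1 * (phi (expi t) * fejer N z t)) =
    phi z - cmean (fun t => phi (expi t) * fejer N z t).
  rewrite cmeanD.
  - by rewrite (cmeanZ _ cF) (cmeanZ _ cpF); ring.
  - by apply: continuousM_real => //; exact: cst_continuous.
  - by apply: continuousM_real => //; exact: cst_continuous.
rewrite -split_ -addrA; apply: le_trans (ler_normD _ _) _; apply: lerD.
  rewrite normrM (ger0_norm F0).
  have -> : 2 * N%:R * B * (1 - normc z) = B * (2 * N%:R * (1 - normc z)) by ring.
  by apply: ler_pM.
have pt t : `|phi z * fejer N z t + - 1 * (phi (expi t) * fejer N z t)| <=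
    e * fejer N z t + K.
  have -> : phi z * fejer N z t + - 1 * (phi (expi t) * fejer N z t) =
    (phi z - phi (expi t)) * fejer N z t by ring.
  rewrite normrM (ger0_norm (fejer_ge0 _ _ _)).
  have [lt|ge] := ltP (normc (z - expi t)) d.
    by rewrite ler_wpDr // ler_wpM2r ?fejer_ge0 // phid.
  apply: (@le_trans _ _ K); last by rewrite lerDr mulr_ge0 // fejer_ge0.
  have -> : K = 2 * B * (4 / (N%:R * d ^+ 2)).
    by rewrite /K; field; rewrite !gt_eqF.
  apply: ler_pM; rewrite ?fejer_ge0 ?fejer_far //.
  apply: le_trans (ler_normB _ _) _.
  by rewrite mulr_natl mulr2n lerD.
have cl : continuous (fun t =>
    phi z * fejer N z t + - 1 * (phi (expi t) * fejer N z t)).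
  move=> t; apply: cvgD; apply: cvgMl_tmp; [exact: cF|exact: cpF].
have cr : continuous (fun t => e * fejer N z t + K).
  by move=> t; apply: cvgD; [apply: cvgMl_tmp; exact: cF|exact: cvg_cst].
have crE : cmean (fun t => e * fejer N z t + K) <= e + K.
  rewrite cmeanD ?(cmeanZ _ cF) ?cmean_cst //; last 2 first.
  - by move=> t; apply: cvgMl_tmp; exact: cF.
  - exact: cst_continuous.
  by rewrite lerD2r -[leRHS]mulr1 ler_wpM2l // -subr_ge0.
apply: le_trans crE; rewrite ler_norml; apply/andP; split; last first.
  by apply: le_cmean => // t; apply: le_trans (ler_norm _) (pt t).
rewrite lerNl -[leLHS]mulN1r -(cmeanZ _ cl); apply: le_cmean => // [|t].
  by move=> t; apply: cvgMl_tmp; exact: cl.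
by have := pt t; rewrite ler_norml => /andP[h _]; lra.
Qed.

End Fejer.

(** * Equidistribution *)

Section compact_support.
Context {R : realType}.
Variable phi : R[i] -> R.
Hypothesis cphi : continuous phi.
Hypothesis kphi : compact (closure [set z | phi z != 0]).

Let out z : ~ closure [set z | phi z != 0] z -> phi z = 0.
Proof.
by move=> nz; apply: contrapT => /eqP z0; apply: nz; exact: subset_closure.
Qed.

Lemma compact_support_bounded : exists B : R, forall z, `|phi z| <= B.
Proof.
have cK : compact (phi @` closure [set z | phi z != 0]).
  by apply: continuous_compact => //; exact: continuous_subspaceT.
have [M [_ hM]] := compact_bounded cK.
exists (`|M| + 1) => z.
have [Kz|nKz] := pselect (closure [set z | phi z != 0] z).
  by apply: (hM (`|M| + 1)); [rewrite (le_lt_trans (ler_norm M)) // ltrDl|exists z].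
by rewrite out // normr0 addr_ge0.
Qed.

(** Compactness of the support gives one radius valid around all its points. If only [w] lies in the
    support the roles are exchanged, and if neither point does both values vanish. *)
Lemma compact_support_unif_continuous (e : R) : 0 < e ->
  exists2 d : R, 0 < d &
    forall z w, normc (z - w) < d -> `|phi z - phi w| <= e.
Proof.
move=> e0.
pose K := closure [set z | phi z != 0].
pose P (d : R) z := forall w, normc (z - w) < d -> `|phi z - phi w| <= e.
have hK : \forall d \near (0 : R)^'+, K `<=` P d.
  move/compact_near_coveringP : kphi; apply => x _.
  have cx : phi y @[y --> x] --> phi x := @cphi x.
  have e20 : 0 < e / 2 by rewrite divr_gt0.
  move/cvgrPdist_lt : cx => /(_ _ e20) /nbhs_normP[/= dC dC0 hd].
  (* The norm of [R[i]] takes values in [R[i]], so the radius is a complex number that must be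
     recognized as real. *)
  have [dE d0] : dC = (Re dC)%:C /\ 0 < Re dC.
    case: dC dC0 {hd} => p q; rewrite ltcE /= => /andP[/eqP -> p0]; by split.
  set d := Re dC in dE d0.
  have {}hd y : normc (x - y) < d -> `|phi x - phi y| < e / 2.
    by move=> xy; apply: hd; rewrite /= dE -normc_real ltcR.
  exists ([set y | normc (x - y) < d / 2], [set r | r < d / 2]) => /=.
    split; last by apply: nbhs_right_lt; rewrite divr_gt0.
    apply/nbhs_normP; exists (d / 2)%:C; first by rewrite /= ltcR divr_gt0.
    by move=> y; rewrite /= -normc_real ltcR.
  move=> [y r] /= [xy rd] w yw.
  have d2 : d / 2 < d by lra.
  have h1 := hd y (lt_trans xy d2).
  have h2 : `|phi x - phi w| < e / 2.
    apply: hd; rewrite -[x - w](subrKA y) (le_lt_trans (le_normcD _ _)) //.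
    by have := lt_trans yw rd; lra.
  rewrite (le_trans (ler_distD (phi x) _ _)) // distrC.
  by lra.
have /filter_ex[d [d0 Kd]] : \forall d \near (0 : R)^'+, 0 < d /\ K `<=` P d.
  by near=> d; split; near: d; [exact: nbhs_right_gt|exact: hK].
exists d => // z w zw.
have [Kz|nKz] := pselect (K z); first exact: Kd.
have [Kw|nKw] := pselect (K w).
  have wz : normc (w - z) < d by rewrite -normcN opprB.
  by rewrite distrC; exact: (Kd w Kw z wz).
by rewrite (out nKz) (out nKw) subrr normr0; exact: ltW.
Unshelve. all: by end_near. Qed.

End compact_support.

(** * Averages of the Fejer kernels over the zeros *)

Section equidistribution.
Context {R : realType}.
Variables (x : forall n : nat, 'I_n -> R[i]) (L S : R).
Arguments x : clear implicits.
Hypothesis injx : forall n, (0 < n)%N -> injective (x n).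
Hypothesis x1 : forall n, (0 < n)%N -> forall k, normc (x n k) <= 1.
Hypothesis energy : forall n, (0 < n)%N ->
  \sum_k \sum_(j | j != k) - ln (normc (x n k - x n j)) <= 2 * n%:R * L.
Hypothesis sumS : forall n, (0 < n)%N -> \sum_k (1 - normc (x n k)) <= S.

Let p n m := normc (\sum_k x n k ^+ m.+1).

(** In [power_sum_le] divided by [n^2], the term [1 - r] is made small by fixing [r] close to 1,
    after which the remaining term is of order [1 / n]. *)
Lemma power_mean_cvg0 m : p n m / n%:R @[n --> \oo] --> 0.
Proof.
apply/cvgr0Pnorm_lt => e e0.
(* With [r = 1 - h] and [h <= 1 / 2], the prefactor [m.+1 / r^m.+1] is at most [K]; the other bound
   on [h] gives [K h <= e^2 / 4]. *)
pose K : R := m.+1%:R * 2 ^+ m.+1.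
have K0 : 0 < K by rewrite mulr_gt0 // exprn_gt0.
pose h := Num.min (1 / 2) (e ^+ 2 / (4 * K)).
have h0 : 0 < h by rewrite lt_min !divr_gt0 ?exprn_gt0 // mulr_gt0.
have h12 : h <= 1 / 2 by rewrite ge_min lexx.
have hK : K * h <= e ^+ 2 / 4.
  apply: (@le_trans _ _ (K * (e ^+ 2 / (4 * K)))).
    by rewrite ler_wpM2l ?(ltW K0) // ge_min lexx orbT.
  by rewrite le_eqVlt; apply/orP; left; apply/eqP; field; rewrite gt_eqF.
have r01 : 0 < 1 - h < 1 by lra.
have rK : m.+1%:R / (1 - h) ^+ m.+1 <= K.
  rewrite ler_wpM2l // -exprVn lerXn2r ?nnegrE ?invr_ge0 //; first lra.
  by rewrite invf_ple ?posrE //; lra.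
pose C := K * `|2 * L - ln h|.
have C0 : 0 <= C by rewrite mulr_ge0 // ltW.
near=> n.
have n0 : (0 < n)%N by near: n; exists 1%N.
have n0' : 0 < n%:R :> R by rewrite ltr0n.
have nC : 2 * C / e ^+ 2 < n%:R by near: n; exact: nbhs_infty_gtr.
have pn0 : 0 <= p n m / n%:R by rewrite divr_ge0 ?normc_ge0.
rewrite ger0_norm // -ltr_sqr ?nnegrE ?(ltW e0) //.
rewrite expr_div_n ltr_pdivrMr ?exprn_gt0 //.
have := power_sum_le (injx n0) (x1 n0) (energy n0) m r01.
rewrite -/(p n m) (_ : 1 - (1 - h) = h); last by ring.
have hL : 2 * L - ln h <= `|2 * L - ln h| by exact: ler_norm.
set E := n%:R * (2 * L - ln h) + n%:R ^+ 2 * h => pE.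
have EC : K * E <= n%:R * C + n%:R ^+ 2 * (e ^+ 2 / 4).
  rewrite /E mulrDr; apply: lerD.
    by rewrite mulrCA /C ler_wpM2l // ler_wpM2l // ltW.
  by rewrite mulrCA ler_wpM2l // sqr_ge0.
move: nC; rewrite ltr_pdivrMr ?exprn_gt0 // => nC.
have nC' : n%:R * C < n%:R ^+ 2 * e ^+ 2 / 2 by nra.
have e2 : 0 < e ^+ 2 * n%:R ^+ 2 by rewrite mulr_gt0 ?exprn_gt0.
(* Enlarging the prefactor to [K] requires [E >= 0]; for negative [E] the bound is already
   nonpositive. *)
have [E0|E0] := leP 0 E.
  have : m.+1%:R / (1 - h) ^+ m.+1 * E <= K * E by rewrite ler_wpM2r.
  by lra.
apply: le_lt_trans pE _; apply: le_lt_trans e2.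
by rewrite mulr_ge0_le0 ?(ltW E0) // divr_ge0 // exprn_ge0 //; lra.
Unshelve. all: by end_near. Qed.

(** Summing over the zeros leaves [N^2] waves with coefficients [c j l], each within [D] of its
    target: [n] on the diagonal, since the zeros accumulate on the circle, and 0 off it, by the
    power sums. The bound is uniform in [t]. *)
Lemma fejer_mean n N t : (0 < n)%N -> (0 < N)%N ->
  `|n%:R^-1 * \sum_k fejer N (x n k) t - 1| <=
  n%:R^-1 * (N%:R * (2 * N%:R * S + \sum_(m < N) p n m)).
Proof.
move=> n0 N0.
have n0' : 0 < n%:R :> R by rewrite ltr0n.
have N0' : 0 < N%:R :> R by rewrite ltr0n.
pose c j l := \sum_k (x n k ^+ j * (x n k)^* ^+ l).
set D := 2 * N%:R * S + _.
have S0 : 0 <= S.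
  by apply: le_trans (sumS n0); apply: sumr_ge0 => k _; rewrite subr_ge0 x1.
have expS j : (j < N)%N -> \sum_k (1 - normc (x n k) ^+ (2 * j)) <= 2 * N%:R * S.
  move=> jN; apply: (@le_trans _ _ (\sum_k (2 * N)%:R * (1 - normc (x n k)))).
    apply: ler_sum => k _; have xk : 0 <= normc (x n k) <= 1 by rewrite normc_ge0 x1.
    have jN2 : (2 * j <= 2 * N)%N by rewrite leq_mul2l ltnW.
    by have /andP[] := expr_1B_le xk jN2.
  by rewrite -mulr_sumr natrM ler_wpM2l ?mulr_ge0 // sumS.
have D0 : 0 <= \sum_(m < N) p n m by apply: sumr_ge0 => m _; exact: normc_ge0.
have cdiag j : c j j = (\sum_k normc (x n k) ^+ (2 * j))%:C.
  rewrite rmorph_sum; apply: eq_bigr => k _ /=.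
  by rewrite -exprMn normc_mulJ -rmorphXn /= -exprM.
have coff j l : (l < j)%N -> (j < N)%N -> normc (c j l) <= D.
  move=> lj jN.
  (* Each term of [c j l] is [x^(j - l) |x|^(2 l)]: a power sum plus a correction that [expS]
     controls. *)
  have -> : c j l = \sum_k x n k ^+ (j - l) +
      \sum_k (x n k ^+ (j - l) * (- (1 - normc (x n k) ^+ (2 * l)))%:C).
    rewrite -big_split /=; apply: eq_bigr => k _.
    rewrite -{1}(subnK (ltnW lj)) exprD -mulrA -exprMn normc_mulJ -rmorphXn /= -exprM.
    by rewrite opprB rmorphB /= rmorph1; ring.
  apply: le_trans (le_normcD _ _) _; rewrite addrC /D; apply: lerD.
    apply: le_trans (expS l (ltn_trans lj jN)).
    apply: le_trans (normc_sum_le _ _) _.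
    apply: ler_sum => k _.
    have h : 0 <= 1 - normc (x n k) ^+ (2 * l).
      by rewrite subr_ge0 exprn_ile1 ?normc_ge0 ?x1.
    rewrite normcM normc_r normrN (ger0_norm h) normcX.
    by rewrite ler_piMl // exprn_ile1 ?normc_ge0 ?x1.
  (* [p n m] is the power sum of order [m.+1], hence the predecessor. *)
  have jl : (j - l = (j - l).-1.+1)%N by rewrite prednK // subn_gt0.
  have jlN : ((j - l).-1 < N)%N by rewrite -jl (leq_trans (leq_subr _ _)) // ltnW.
  rewrite jl -/(p n _) (bigD1 (Ordinal jlN)) //= lerDl.
  by apply: sumr_ge0 => m _; exact: normc_ge0.
have cC j l : normc (c j l) = normc (c l j).
  rewrite -normc_conj rmorph_sum; congr normc; apply: eq_bigr => k _ /=.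
  by rewrite rmorphM !rmorphXn /= conjcK mulrC.
have main j l : (j < N)%N -> (l < N)%N ->
    `|wave (c j l) j l t - (j == l)%:R * n%:R| <= D.
  move=> jN lN; case: eqVneq => [->|jl].
    rewrite waveE subrr mul0r cos0 sin0 mulr1 mulr0 subr0 mul1r cdiag /=.
    rewrite distrC -[n in n%:R]card_ord -sumr_const -sumrB ger0_norm.
      by apply: le_trans (expS l lN) _; rewrite lerDl.
    by apply: sumr_ge0 => k _; rewrite subr_ge0 exprn_ile1 ?normc_ge0 ?x1.
  rewrite mul0r subr0; apply: le_trans (normc_Re _) _.
  rewrite !normcM !normcX normc_conj normc_expi !expr1n !mulr1.
  by case: (ltngtP j l) jl => // h _; [rewrite cC|]; exact: coff.
have sumE : \sum_k fejer N (x n k) t =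
    N%:R^-1 * \sum_(j < N) \sum_(l < N) wave (c j l) j l t.
  rewrite /fejer -mulr_sumr; congr (_ * _); rewrite exchange_big /=.
  apply: eq_bigr => j _; rewrite exchange_big /=; apply: eq_bigr => l _.
  by rewrite /c /wave mulr_suml Re_sum.
have -> : n%:R^-1 * \sum_k fejer N (x n k) t - 1 = n%:R^-1 * (N%:R^-1 *
    \sum_(j < N) \sum_(l < N) (wave (c j l) j l t - (j == l)%:R * n%:R)).
  have dE : \sum_(j < N) \sum_(l < N) (j == l)%:R * n%:R = N%:R * n%:R :> R.
    transitivity (\sum_(j < N) n%:R : R); last by rewrite sumr_const card_ord mulr_natl.
    apply: eq_bigr => j _; rewrite (bigD1 j) //= eqxx mul1r big1 ?addr0 // => l lj.
    by rewrite eq_sym (negbTE lj) mul0r.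
  rewrite sumE; under [in RHS]eq_bigr do rewrite sumrB.
  rewrite sumrB dE; field.
  by rewrite !gt_eqF.
rewrite normrM ger0_norm ?invr_ge0 // ler_wpM2l ?invr_ge0 //.
rewrite normrM ger0_norm ?invr_ge0 // ler_pdivrMl //.
apply: le_trans (ler_norm_sum _ _ _) _.
rewrite -[leRHS](_ : \sum_(j < N) \sum_(l < N) D = _); last first.
  by rewrite !sumr_const !card_ord !mulr_natl.
apply: ler_sum => j _; apply: le_trans (ler_norm_sum _ _ _) _.
by apply: ler_sum => l _; exact: main.
Qed.

(** Each [phi (x n k)] is replaced by its Fejer mean; exchanging the sum over zeros with the mean
    over the circle leaves [phi] integrated against [V], which [fejer_mean] shows to be uniformly
    close to 1. *)
Lemma zero_mean_approx (phi : R[i] -> R) (B e d : R) n N : continuous phi ->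
  (forall z, `|phi z| <= B) -> 0 < d ->
  (forall z w, normc (z - w) < d -> `|phi z - phi w| <= e) ->
  (0 < n)%N -> (0 < N)%N ->
  `|n%:R^-1 * \sum_k phi (x n k) - cmean (phi \o expi)| <=
  e + 8 * B / (N%:R * d ^+ 2) + 2 * N%:R * B * S / n%:R +
  B * (n%:R^-1 * (N%:R * (2 * N%:R * S + \sum_(m < N) p n m))).
Proof.
move=> cphi phiB d0 phid n0 N0.
have n0' : 0 < n%:R :> R by rewrite ltr0n.
have N0' : 0 < N%:R :> R by rewrite ltr0n.
have B0 : 0 <= B := le_trans (normr_ge0 _) (phiB 0).
have cpe : continuous (fun t : R => phi (expi t)).
  by move=> t; apply: continuous_comp; [exact: continuous_expi|exact: cphi].
have cF k := @continuous_fejer R N (x n k).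
have cpF k := continuousM_real cpe (cF k).
pose g k := cmean (fun t => phi (expi t) * fejer N (x n k) t).
pose V t := n%:R^-1 * \sum_k fejer N (x n k) t.
have cS : continuous (fun t => \sum_k fejer N (x n k) t).
  by move=> t; apply: cvg_big => // [|k _]; [exact: add_continuous|exact: cF].
have cV : continuous V by move=> t; apply: cvgMl_tmp; exact: cS.
have gE : n%:R^-1 * \sum_k g k = cmean (fun t => phi (expi t) * V t).
  rewrite -cmean_sum // -cmeanZ; last first.
    by move=> t; apply: cvg_big => // [|k _]; [exact: add_continuous|exact: cpF].
  congr cmean; apply/funext => t.
  by rewrite /V [RHS]mulrCA; congr (_ * _); rewrite mulr_sumr.
have -> : n%:R^-1 * \sum_k phi (x n k) - cmean (phi \o expi) =
   n%:R^-1 * \sum_k (phi (x n k) - g k) +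
   (n%:R^-1 * \sum_k g k - cmean (phi \o expi)).
  by rewrite sumrB mulrBr; ring.
apply: le_trans (ler_normD _ _) _; apply: lerD.
  rewrite normrM ger0_norm ?invr_ge0 // mulrC ler_pdivrMr //.
  apply: le_trans (ler_norm_sum _ _ _) _.
  apply: (@le_trans _ _ (\sum_k (2 * N%:R * B * (1 - normc (x n k)) +
    (e + 8 * B / (N%:R * d ^+ 2))))).
    by apply: ler_sum => k _; rewrite addrA; apply: fejer_approx => //; exact: x1.
  rewrite big_split /= sumr_const card_ord -mulr_sumr -[X in _ + X]mulr_natr.
  rewrite [leRHS]mulrDl mulfVK ?gt_eqF // addrC lerD2l ler_wpM2l ?sumS //.
  by rewrite !mulr_ge0.
have -> : n%:R^-1 * \sum_k g k - cmean (phi \o expi) =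
    cmean (fun t => phi (expi t) * (V t - 1)).
  rewrite gE -[- _]mulN1r -cmeanZ // -cmeanD //.
  - by congr cmean; apply/funext => t /=; ring.
  - exact: continuousM_real.
  - by move=> t; apply: cvgMl_tmp; exact: cpe.
apply: cmean_abs_le => [|t].
  apply: continuousM_real => // t; apply: cvgB; [exact: cV|exact: cvg_cst].
by rewrite normrM ler_pM // fejer_mean.
Qed.

End equidistribution.

Theorem theorem1p1 (R : realType) (M : R) (P : nat -> {poly int})
    (a : nat -> int) (alpha : forall n : nat, n.-tuple R[i]) :
  0 < M ->
  (forall n : nat, (0 < n)%N ->
    [/\ size (P n) = n.+1,
        map_poly intr (P n) =
          (a n)%:~R *: \prod_(k < n) ('X - (tnth (alpha n) k)%:P),
        injective (tnth (alpha n)),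
        forall k : 'I_n, `|tnth (alpha n) k| <= 1
      & `|(a n)%:~R| <= M]) ->
  weak_cvg (fun n => zero_counting (alpha n)) circle_measure.
Proof.
move=> _ hP phi cphi kphi.
pose x n := tnth (alpha n).
pose L := ln M; pose S := 1 + ln M.
have injx n : (0 < n)%N -> injective (x n) by move=> /hP[].
have x1 n (n0 : (0 < n)%N) k : normc (x n k) <= 1.
  by rewrite normc_le1; have [_ _ _ x1 _] := hP n n0; exact: x1.
have energy n (n0 : (0 < n)%N) :
    \sum_k \sum_(j | j != k) - ln (normc (x n k - x n j)) <= 2 * n%:R * L.
  by have [sP PE inj _ aM] := hP n n0; exact: (log_energy_le sP PE inj aM).
have sumS n (n0 : (0 < n)%N) : \sum_k (1 - normc (x n k)) <= S.
  have [sP PE inj _ aM] := hP n n0.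
  exact: (sum_1Bnormc_le sP PE inj aM (x1 n n0)).
have [B phiB] := compact_support_bounded cphi kphi.
have B0 : 0 <= B := le_trans (normr_ge0 _) (phiB 0).
rewrite (integral_circle cphi).
under eq_fun do rewrite (integral_counting _ cphi).
apply: cvg_EFin; first exact: nearW.
apply/cvgrPdist_le => /= e e0.
(* Four errors share [e]: [d] handles the oscillation of [phi] and [N] the tail of the kernel, both
   fixed before [n] grows; the other two vanish as [n] tends to infinity. *)
have e40 : 0 < e / 4 by rewrite divr_gt0.
have [d d0 phid] := compact_support_unif_continuous cphi kphi e40.
have [N N0 NB] : exists2 N, (0 < N)%N & 8 * B / (N%:R * d ^+ 2) <= e / 4.
  pose N := (Num.bound (32 * B / (e * d ^+ 2))).+1.
  exists N => //; have N0 : 0 < N%:R :> R by [].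
  rewrite ler_pdivrMr ?mulr_gt0 ?exprn_gt0 //.
  have c0 : 0 <= 32 * B / (e * d ^+ 2).
    by rewrite divr_ge0 // mulr_ge0 ?(ltW e0) ?sqr_ge0.
  have := archi_boundP c0; rewrite ltr_pdivrMr ?mulr_gt0 ?exprn_gt0 // => h.
  have : (Num.bound (32 * B / (e * d ^+ 2)))%:R * (e * d ^+ 2) <=
      N%:R * (e * d ^+ 2).
    by rewrite ler_wpM2r ?mulr_ge0 ?exprn_ge0 ?(ltW d0) ?(ltW e0) // ler_nat.
  by move: h; lra.
pose p n m := normc (\sum_k x n k ^+ m.+1).
(* For fixed [N], [c / n] collects the errors controlled by [S], and [rest n] the one from the power
   sums. *)
pose c := 2 * N%:R * B * S + B * (N%:R * (2 * N%:R * S)).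
pose rest n : R := B * N%:R * (\sum_(m < N) p n m / n%:R).
have rest0 : rest n @[n --> \oo] --> 0.
  have s0 : \sum_(m < N) p n m / n%:R @[n --> \oo] --> \sum_(m < N) (0 : R).
    apply: cvg_big => [|m _]; first exact: add_continuous.
    exact: (power_mean_cvg0 injx x1 energy).
  rewrite big1 // in s0; rewrite -(mulr0 (B * N%:R)).
  exact: cvgMl_tmp s0.
near=> n.
have n0 : (0 < n)%N by near: n; exists 1%N.
have n0' : 0 < n%:R :> R by rewrite ltr0n.
have cn : c / n%:R <= e / 4.
  rewrite ler_pdivrMr // mulrC -ler_pdivrMr //.
  by near: n; exact: nbhs_infty_ger.
have rn : rest n <= e / 4.
  apply: le_trans (ler_norm _) _.
  by near: n; exact: (cvgr0_norm_le _ rest0).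
rewrite distrC.
have := zero_mean_approx x1 sumS cphi phiB d0 phid n0 N0.
rewrite -/(p n) => /le_trans; apply.
have -> : B * (n%:R^-1 * (N%:R * (2 * N%:R * S + \sum_(m < N) p n m))) =
    B * (N%:R * (2 * N%:R * S)) / n%:R + rest n.
  by rewrite /rest -mulr_suml; ring.
have cE : c / n%:R = 2 * N%:R * B * S / n%:R + B * (N%:R * (2 * N%:R * S)) / n%:R.
  by rewrite /c mulrDl.
lra.
Unshelve. all: by end_near. Qed.
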